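(* Let $(X,d)$ be a compact metric space and $\boldsymbol f=\{f_i\}_{i=1}^\infty$ a sequence of continuous self-maps of $X$. For any compact subset $Z\subseteq X$, any $\varphi\in C(X,\mathbb R)$ and any $\theta\in[0,1]$, we have $$\underline P(\boldsymbol f,Z,\varphi,\theta)=\sup\bigl\{\underline P_\mu(\boldsymbol f,\varphi,\theta):\mu\in\mathcal M(X),\ \mu(Z)=1\bigr\},$$ $$\overline P(\boldsymbol f,Z,\varphi,\theta)=\sup\bigl\{\overline P_\mu(\boldsymbol f,\varphi,\theta):\mu\in\mathcal M(X),\ \mu(Z)=1\bigr\}.$$ Here $\underline P,\overline P$ are the lower and upper $\theta$-intermediate topological pressures and $\underline P_\mu,\overline P_\mu$ the lower and upper $\theta$-intermediate measure-theoretic pressures.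
   Context: All pressures take values in $[-\infty,+\infty]$, with $\inf\emptyset=+\infty$, $\sup\emptyset=-\infty$. $C(X,\mathbb R)$ is the space of continuous real functions on $X$ with the supremum norm. Put $f_1^0=\mathrm{id}_X$, $f_1^n=f_n\circ\cdots\circ f_1$ for $n\ge1$, and $S_n\varphi(x)=\sum_{j=0}^{n-1}\varphi(f_1^j x)$. Topological pressures. For a finite open cover $\mathcal U$ of $X$, $\mathcal S_m(\mathcal U)$ is the set of strings $\mathbf U=(U_0,\dots,U_{m-1})$ with all $U_j\in\mathcal U$; $m(\mathbf U)=m$ is the length of $\mathbf U$; and $X(\mathbf U)=\{x\in X: f_1^j(x)\in U_j,\ 0\le j\le m-1\}$. For $Z\subseteq X$, $\alpha\in\mathbb R$, $N\in\mathbb N$, $\theta\in[0,1]$ let $$M(Z,\alpha,\varphi,\mathcal U,N,\theta)=\inf_{\mathcal G}\sum_{\mathbf U\in\mathcal G}\exp\Bigl(-\alpha m(\mathbf U)+\sup_{x\in X(\mathbf U)}S_{m(\mathbf U)}\varphi(x)\Bigr),$$ the infimum over all finite or countable collections $\mathcal G$ of strings of lengths $m$ with $N\le m<N/\theta+1$ (for $\theta=0$: $m\ge N$) such that $Z\subseteq\bigcup_{\mathbf U\in\mathcal G}X(\mathbf U)$; the supremum over an empty $X(\mathbf U)$ is $-\infty$ (so the term is $0$). Let $\underline m$ and $\overline m$ be the $\liminf$ and $\limsup$ of $M(Z,\alpha,\varphi,\mathcal U,N,\theta)$ as $N\to\infty$, and $$\underline P(\boldsymbol f,Z,\varphi,\mathcal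 U,\theta)=\inf\{\alpha:\underline m=0\}=\sup\{\alpha:\underline m=\infty\},\quad \overline P(\boldsymbol f,Z,\varphi,\mathcal U,\theta)=\inf\{\alpha:\overline m=0\}=\sup\{\alpha:\overline m=\infty\}.$$ With $|\mathcal U|=\max_{U\in\mathcal U}\operatorname{diam}U$, the lower and upper $\theta$-intermediate topological pressures are $\underline P(\boldsymbol f,Z,\varphi,\theta)=\lim_{|\mathcal U|\to0}\underline P(\boldsymbol f,Z,\varphi,\mathcal U,\theta)$ and $\overline P(\boldsymbol f,Z,\varphi,\theta)=\lim_{|\mathcal U|\to0}\overline P(\boldsymbol f,Z,\varphi,\mathcal U,\theta)$ (these limits exist). Measure-theoretic pressures. $\mathcal M(X)$ is the set of Borel probability measures on $X$. $B_n(x,\varepsilon)=\{y\in X:\max_{0\le j\le n-1}d(f_1^j x,f_1^j y)<\varepsilon\}$ is the Bowen ball. A family $\mathcal S$ of Bowen balls is a $\mu$-cover if $\mu(\bigcup_{B\in\mathcal S}B)=1$. Let $$M_\mu(\boldsymbol f,\alpha,\varphi,\varepsilon,N,\theta)=\inf\sum_i\exp\Bigl(-\alpha n_i+\sup_{y\in B_{n_i}(x_i,\varepsilon)}S_{n_i}\varphi(y)\Bigr),$$ the infimum over all finite $\mu$-covers $\{B_{n_i}(x_i,\varepsilon)\}_i$ ($x_i\in X$) with $N\le n_i\le N/\theta$ if $\theta>0$, and $n_i\ge N$ if $\theta=0$. Let $\underline m_\mu(\boldsymbol f,\alpha,\varphi,\varepsilon,\theta)$ and $\overline m_\mu(\boldsymbol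 f,\alpha,\varphi,\varepsilon,\theta)$ be its $\liminf$ and $\limsup$ as $N\to\infty$, $\underline P_\mu(\boldsymbol f,\varphi,\varepsilon,\theta)=\inf\{\alpha:\underline m_\mu=0\}=\sup\{\alpha:\underline m_\mu=\infty\}$, similarly $\overline P_\mu(\boldsymbol f,\varphi,\varepsilon,\theta)$ with $\overline m_\mu$, and $$\underline P_\mu(\boldsymbol f,\varphi,\theta)=\lim_{\varepsilon\to0}\underline P_\mu(\boldsymbol f,\varphi,\varepsilon,\theta),\qquad \overline P_\mu(\boldsymbol f,\varphi,\theta)=\lim_{\varepsilon\to0}\overline P_\mu(\boldsymbol f,\varphi,\varepsilon,\theta).$$ *)

(* Defs.v *)
From HB Require Import structures.
From mathcomp Require Export all_boot all_order all_algebra.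
From mathcomp Require Export all_classical all_reals all_analysis.

Set Implicit Arguments.
Unset Strict Implicit.
Unset Printing Implicit Defensive.

Import Order.TTheory GRing.Theory Num.Theory.
Import numFieldNormedType.Exports.

Local Open Scope classical_set_scope.
Local Open Scope ring_scope.

(* Measurable types are pointed in the library, so a metric space carrying a
   Borel sigma-algebra has to be pointed as well. *)
#[short(type="pointedMetricType")]
HB.structure Definition PointedMetric (R : numDomainType) :=
  {X of Metric R X & isPointed X}.

Notation borelType X := (g_sigma_algebraType (@open X)).

Section Dynamics.
Context {R : realType} {X : pointedMetricType R}.
Implicit Types (f : nat -> X -> X) (phi : X -> R).

(* The maps of the system are f 1, f 2, ...; the value f 0 is never used. *)
Fixpoint orbit_map f (n : nat) (x : X) : X :=
  if n is m.+1 then f m.+1 (orbit_map f m x) else x.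

Definition birkhoff_sum f phi (n : nat) (x : X) : R :=
  \sum_(j < n) phi (orbit_map f j x).

(* exp(- alpha n + sup_A S_n phi); it is 0 when A is empty, as the supremum is
   then -oo. *)
Definition weight f phi (alpha : R) (n : nat) (A : set X) : \bar R :=
  expeR ((- alpha * n%:R)%:E
         + ereal_sup [set (birkhoff_sum f phi n x)%:E | x in A])%E.

Definition critical_value (m : R -> \bar R) : \bar R :=
  ereal_inf [set alpha%:E | alpha in [set alpha | m alpha = 0%E]].

Definition finite_open_cover (U : set (set X)) : Prop :=
  [/\ finite_set U, U `<=` open & \bigcup_(V in U) V = [set: X]].

Definition diameter (A : set X) : \bar R :=
  ereal_sup [set (mdist p.1 p.2)%:E | p in A `*` A].

Definition mesh (U : set (set X)) : \bar R := ereal_sup [set diameter V | V in U].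

(* The filter of finite open covers U with |U| -> 0; a vanishing mesh is
   allowed, as it must be when X is finite. *)
Definition mesh_to0 : set_system (set (set X)) :=
  filter_from [set delta : R | 0 < delta]
    (fun delta => [set U | finite_open_cover U /\ (mesh U < delta%:E)%E]).

Definition is_string (U : set (set X)) (s : seq (set X)) : Prop :=
  forall j, (j < size s)%N -> U (nth set0 s j).

Definition string_set f (s : seq (set X)) : set X :=
  [set x | forall j, (j < size s)%N -> nth set0 s j (orbit_map f j x)].

Definition string_window (theta : R) (N m : nat) : Prop :=
  (N <= m)%N /\ (0 < theta -> m%:R < N%:R / theta + 1).

Definition string_covering f (Z : set X) (U : set (set X)) (N : nat) (theta : R)
    (G : set (seq (set X))) : Prop :=
  [/\ countable G,
      forall s, G s -> is_string U s /\ string_window theta N (size s) &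
      Z `<=` \bigcup_(s in G) string_set f s].

Definition top_sum f Z alpha phi U N theta : \bar R :=
  ereal_inf [set \esum_(s in G) weight f phi alpha (size s) (string_set f s)
            | G in string_covering f Z U N theta].

Definition lower_cover_pressure f Z phi theta U : \bar R :=
  critical_value (fun alpha =>
    limn_einf (fun N => top_sum f Z alpha phi U N theta)).

Definition upper_cover_pressure f Z phi theta U : \bar R :=
  critical_value (fun alpha =>
    limn_esup (fun N => top_sum f Z alpha phi U N theta)).

Definition lower_pressure f Z phi theta : \bar R :=
  lim (lower_cover_pressure f Z phi theta U @[U --> mesh_to0]).

Definition upper_pressure f Z phi theta : \bar R :=
  lim (upper_cover_pressure f Z phi theta U @[U --> mesh_to0]).

Definition bowen_ball f (n : nat) (x : X) (eps : R) : set X :=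
  [set y | forall j, (j < n)%N -> mdist (orbit_map f j x) (orbit_map f j y) < eps].

Definition ball_window (theta : R) (N n : nat) : Prop :=
  (N <= n)%N /\ (0 < theta -> n%:R <= N%:R / theta).

Implicit Type mu : probability (borelType X) R.

(* A finite family of Bowen balls is given by the list of its centers and
   lengths, since a ball may have several centers and lengths. *)
Definition ball_covering f mu (eps : R) (N : nat) (theta : R)
    (S : seq (X * nat)) : Prop :=
  (forall p, p \in S -> ball_window theta N p.2) /\
  mu (\bigcup_(p in [set` S]) bowen_ball f p.2 p.1 eps) = 1%E.

Definition meas_sum f mu alpha phi eps N theta : \bar R :=
  ereal_inf [set (\sum_(p <- S) weight f phi alpha p.2 (bowen_ball f p.2 p.1 eps))%E
            | S in ball_covering f mu eps N theta].

Definition lower_meas_pressure_at f mu phi theta eps : \bar R :=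
  critical_value (fun alpha =>
    limn_einf (fun N => meas_sum f mu alpha phi eps N theta)).

Definition upper_meas_pressure_at f mu phi theta eps : \bar R :=
  critical_value (fun alpha =>
    limn_esup (fun N => meas_sum f mu alpha phi eps N theta)).

Definition lower_meas_pressure f mu phi theta : \bar R :=
  lim (lower_meas_pressure_at f mu phi theta eps @[eps --> 0^'+]).

Definition upper_meas_pressure f mu phi theta : \bar R :=
  lim (upper_meas_pressure_at f mu phi theta eps @[eps --> 0^'+]).

End Dynamics.

(* Main.v *)
(* Choose a sequence dense in [Z] and let mu charge each of its points.  A finite
   union of Bowen balls of radius eps that has full mu-measure is dense in [Z], so
   doubling the radii makes it a cover of [Z]: this single mu already computes the
   topological pressure.  Conversely, by compactness, a cover of [Z] by strings has
   a finite subcover, which lies in a finite union of Bowen balls and is thus a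
   cover for every measure carried by [Z].  All changes of scale cost at most the
   oscillation of [phi] at that scale, which tends to 0; as the pressures need not
   be monotone in the scale, this is also why their limits exist. *)
From HB Require Import structures.
Require Import Defs.
From mathcomp Require Import lra.

Import Order.TTheory GRing.Theory Num.Theory.
Import numFieldNormedType.Exports.

Local Open Scope classical_set_scope.
Local Open Scope ring_scope.

(** * Liminf, limsup, critical values and limits as a scale shrinks *)

Section Limits.
Set Implicit Arguments.
Unset Strict Implicit.
Context {R : realType}.
Implicit Types (u v : nat -> \bar R) (m : R -> \bar R).

(** The comparisons of pressures use only this property of [limn_einf] and [limn_esup], so the lower
    and upper cases are treated together. The constant [K] is harmless because a critical value only
    records where the limit vanishes. *)
Definition dominates_vanishing (lim_op : (nat -> \bar R) -> \bar R) : Prop :=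
  forall (K : R) u v, 0 < K ->
    (forall N, 0 <= u N)%E -> (forall N, 0 <= v N)%E ->
    (forall N, u N <= K%:E * v N)%E -> lim_op v = 0%E -> lim_op u = 0%E.

Lemma limn_einf_ge0 u : (forall N, 0 <= u N)%E -> (0 <= limn_einf u)%E.
Proof.
move=> u0; rewrite limn_einf_lim; apply: lime_ge; first exact: is_cvg_einfs.
by apply: nearW => n; apply: le_ereal_inf_tmp => _ [k _ <-].
Qed.

Lemma dominates_vanishing_limn_einf : dominates_vanishing limn_einf.
Proof.
move=> K u v K0 u0 v0 uv v_0; apply/eqP; rewrite eq_le limn_einf_ge0// andbT.
have H : (limn_einf u <= K%:E * limn_einf v)%E.
  rewrite !limn_einf_lim -limeMl//; last exact: is_cvg_einfs.
  apply: lee_lim; [exact: is_cvg_einfs | |].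
    by apply: is_cvgeMl => //; exact: is_cvg_einfs.
  apply: nearW => n; rewrite /einfs/= -ereal_inf_pZl//.
  apply: le_ereal_inf_tmp => _ [_ [k nk <-] <-].
  by apply: ge_ereal_inf; exists (u k) => //; exists k.
by rewrite v_0 mule0 in H.
Qed.

Lemma dominates_vanishing_limn_esup : dominates_vanishing limn_esup.
Proof.
move=> K u v K0 u0 v0 uv v_0; apply/eqP; rewrite eq_le; apply/andP; split; last first.
  by apply: le_trans (limn_einf_sup u); exact: limn_einf_ge0.
have H : (limn_esup u <= K%:E * limn_esup v)%E.
  rewrite !limn_esup_lim -limeMl//; last exact: is_cvg_esups.
  apply: lee_lim; [exact: is_cvg_esups | |].
    by apply: is_cvgeMl => //; exact: is_cvg_esups.
  apply: nearW => n; rewrite /esups/= -ereal_sup_pZl//.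
  apply: ge_ereal_sup => _ [k nk <-].
  by apply: le_ereal_sup_tmp; exists (K%:E * v k)%E => //; exists (v k) => //; exists k.
by rewrite v_0 mule0 in H.
Qed.

(** Every comparison of pressures below has this form: raising [alpha] by [eta] pays for an
    oscillation [eta] of [phi] at each step of an orbit. *)
Lemma critical_value_leD m1 m2 (eta : R) :
  (forall alpha, m2 alpha = 0%E -> m1 (alpha + eta) = 0%E) ->
  (critical_value m1 <= critical_value m2 + eta%:E)%E.
Proof.
move=> m12; rewrite -leeBlDr//; apply: le_ereal_inf_tmp => _ [a ma <-].
rewrite leeBlDr; last by []. apply: ge_ereal_inf; exists (a + eta)%:E => //.
by exists (a + eta) => //=; exact: m12.
Qed.

(* Equivalent to [p @ F --> l] for every [l : \bar R], but the two halves can be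
   fed estimates that hold only up to an additive error. *)
Definition tends_to {T : Type} (F : set_system T) (p : T -> \bar R)
    (l : \bar R) : Prop :=
  (forall eta : R, 0 < eta -> \forall t \near F, (p t <= l + eta%:E)%E) /\
  (forall eta a : R, 0 < eta -> (a%:E < l)%E ->
     \forall t \near F, (a%:E <= p t + eta%:E)%E).

Lemma tends_to_cvg (T : Type) (F : set_system T) (p : T -> \bar R) (l : \bar R) :
  Filter F -> tends_to F p l -> p @ F --> l.
Proof.
move=> FF [up low]; case: l up low => [l| |] up low.
- have near_l (e : R) : 0 < e -> \forall t \near F,
      ((l - e)%:E <= p t)%E /\ (p t <= (l + e)%:E)%E.
    move=> e0; near=> t; split; last by rewrite EFinD; near: t; exact: up.
    (* [low] needs a number strictly below [l] and itself loses an additive error, so [e] is shared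
       between the two. *)
    rewrite (_ : l - e = l - e / 2 - e / 2); last by lra.
    rewrite EFinB leeBlDr//; near: t; apply: low; first by rewrite divr_gt0.
    by rewrite lte_fin ltrBlDr ltrDl divr_gt0.
  apply/fine_cvgP; split.
    near=> t; rewrite fin_numElt; apply/andP.
    have [l1 l2] : ((l - 1)%:E <= p t)%E /\ (p t <= (l + 1)%:E)%E.
      by near: t; apply: near_l; exact: ltr01.
    split; [exact: lt_le_trans (ltNyr _) l1 | exact: le_lt_trans l2 (ltry _)].
  apply/cvgrPdist_le => e e0; near=> t => /=.
  have : ((l - e)%:E <= p t)%E /\ (p t <= (l + e)%:E)%E.
    by near: t; exact: near_l.
  case: (p t) => [r| |] /=; rewrite ?leye_eq ?leeNy_eq; try by case.
  by rewrite !lee_fin => -[le re]; rewrite ler_norml; lra.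
- apply/cvgeyPge => A; near=> t.
  rewrite -(@leeD2rE _ 1%:E)// -EFinD.
  by near: t; apply: low => //; rewrite ltry.
- apply/cvgeNyPle => A; near=> t.
  apply: (@le_trans _ _ (-oo + 1%:E)%E); last by rewrite addNye leNye.
  by near: t; apply: up; exact: ltr01.
Unshelve. all: by end_near. Qed.

(** The limit is the liminf at [0], written as the supremum of the eventual lower bounds. The
    hypothesis makes [p e - eta] such a bound for small [e], which gives the upper half; the lower
    half holds for any [p]. *)
Lemma tends_to_liminf (p : R -> \bar R) :
  (forall eta : R, 0 < eta -> exists2 delta : R, 0 < delta &
     forall e e', 0 < e' -> e' <= e -> e <= delta -> (p e <= p e' + eta%:E)%E) ->
  exists l, tends_to 0^'+ p l.
Proof.
move=> quasi.
exists (ereal_sup [set a : \bar R | exists2 e0 : R, 0 < e0 &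
  forall e, 0 < e -> e <= e0 -> (a <= p e)%E]); split.
- move=> eta /quasi[delta d0 dP]; near=> e.
  rewrite -leeBlDr//; apply: ereal_sup_ubound; exists e => [|e' e'0 e'e].
    by near: e; exact: nbhs_right_gt.
  rewrite leeBlDr//; apply: dP => //.
  by near: e; exact: nbhs_right_le.
- move=> eta a eta0 /ereal_sup_gt[b [e0 e00 e0P] ab]; near=> e.
  apply: (@le_trans _ _ (p e)); last by rewrite leeDl// lee_fin ltW.
  apply: le_trans (ltW ab) _; apply: e0P.
    by near: e; exact: nbhs_right_gt.
  by near: e; exact: nbhs_right_le.
Unshelve. all: by end_near. Qed.

End Limits.

(** * Borel probabilities whose atoms are dense in a compact set *)

Section FullSupport.
Set Implicit Arguments.
Unset Strict Implicit.
Context {R : realType} {X : pointedMetricType R}.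
Implicit Types (Z : set X).

Lemma open_measurable_borel (A : set X) : open A -> measurable (A : set (borelType X)).
Proof. exact: sub_sigma_algebra. Qed.

Lemma compact_measurable_borel Z : compact Z -> measurable (Z : set (borelType X)).
Proof.
move=> cptZ; have Zcl : closed Z by apply: compact_closed cptZ; exact: metric_hausdorff.
rewrite -[X in measurable X]setCK; apply: measurableC; apply: open_measurable_borel.
by rewrite openC.
Qed.

Lemma probability_eq1_subset (mu : probability (borelType X) R) (A B : set X) :
  measurable (A : set (borelType X)) -> measurable (B : set (borelType X)) ->
  A `<=` B -> mu A = 1%E -> mu B = 1%E.
Proof.
move=> mA mB AB muA; apply/eqP; rewrite eq_le probability_le1//= -muA.
by rewrite le_measure ?inE.
Qed.

Lemma dense_sequence Z : compact [set: X] -> Z !=set0 ->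
  exists z : nat -> X, (forall n, Z (z n)) /\
    forall x V, Z x -> nbhs x V -> exists n, V (z n).
Proof.
move=> cptX [z0 Zz0].
have [B /countable_injP[g] ginj [_ Bbase]] := compact_second_countable cptX.
(* Pick a point of [Z] in each set of a countable base that meets [Z]. The injection [g] numbers the
   base, and [z0] serves for the numbers of no such set. *)
have zex n : exists x, Z x /\
    forall V, B V -> g V = n -> (V `&` Z) !=set0 -> V x.
  have [[V [BV gV [x [Vx Zx]]]]|noV] :=
      pselect (exists V, [/\ B V, g V = n & (V `&` Z) !=set0]).
    exists x; split=> // W BW gW _; suff -> : W = V by [].
    by apply: ginj; rewrite ?inE// gW gV.
  by exists z0; split=> // V BV gV VZ; exfalso; apply: noV; exists V.
have [z zP] := boolp.choice zex.
exists z; split=> [n|x V Zx xV]; first by have [] := zP n.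
have [W [BW Wx] WV] := Bbase x V xV.
exists (g W); apply: WV; have [_] := zP (g W); apply=> //.
by exists x.
Qed.

Definition atomic_measure (z : nat -> X) : set (borelType X) -> \bar R :=
  mseries (fun n => mscale ((2 ^ n.+1)%:R^-1%:nng : {nonneg R})
                      (dirac (z n : borelType X))) 0.

HB.instance Definition _ z := Measure.on (atomic_measure z).

Lemma atomic_measureE z (A : set X) :
  atomic_measure z A = (\sum_(0 <= n <oo) ((2 ^ n.+1)%:R^-1)%:E * \d_(z n : borelType X) A)%E.
Proof. by []. Qed.

Lemma atomic_measure_eq1 z (A : set X) : (forall n, A (z n)) -> atomic_measure z A = 1%E.
Proof.
move=> zA; rewrite atomic_measureE (_ : 1%E = (1 / 2 ^+ 0)%:E); last first.
  by rewrite expr0 divr1.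
apply/cvg_lim => //; rewrite -[X in X @ _ --> _]/(eseries _).
rewrite (_ : (fun n => _) = (fun k => (1 / (2 ^ (k + 1))%:R)%:E)).
  exact: cvg_geometric_eseries_half.
by apply/funext => n; rewrite diracE mem_set// mule1 mul1r addn1.
Qed.

HB.instance Definition _ z :=
  Measure_isProbability.Build _ _ _ (atomic_measure z)
    (@atomic_measure_eq1 z [set: X] (fun=> I)).

(** If [A] missed [z n], its complement would carry at least the mass [1 / 2 ^ n.+1] of that
    atom. *)
Lemma atomic_measure_charges z (A : set X) : measurable (A : set (borelType X)) ->
  atomic_measure z A = 1%E -> forall n, A (z n).
Proof.
move=> mA muA n; apply: contrapT => nAz.
have : (atomic_measure z (~` A) = 1 - 1)%E by rewrite -{2}muA; exact: probability_setC.
rewrite subee// => /eqP; apply/negP; rewrite gt_eqF// atomic_measureE.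
rewrite (nneseriesD1 (n := n))//; last by move=> k _; apply: mule_ge0.
rewrite diracE mem_set// mule1; apply: (@lt_le_trans _ _ ((2 ^ n.+1)%:R^-1 : R)%:E).
  by rewrite lte_fin invr_gt0 ltr0n expn_gt0.
rewrite leeDl//; apply: nneseries_ge0 => m _ _.
by apply: mule_ge0.
Qed.

Lemma full_support_probability Z : compact [set: X] -> Z !=set0 ->
  exists2 mu : probability (borelType X) R, mu Z = 1%E &
    forall A, open A -> mu A = 1%E -> Z `<=` closure A.
Proof.
move=> cptX /(dense_sequence cptX)[z [zZ zdense]].
exists (atomic_measure z); first exact: atomic_measure_eq1.
move=> A Aopen /(atomic_measure_charges (open_measurable_borel Aopen)) zA x Zx V xV.
by have [n Vzn] := zdense x V Zx xV; exists (z n).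
Qed.

End FullSupport.

(** * Uniformity from compactness *)

Section Dynamics.
Set Implicit Arguments.
Unset Strict Implicit.
Context {R : realType} {X : pointedMetricType R}.
Context (f : nat -> X -> X) (phi : X -> R).
Implicit Types (U : set (set X)) (Z : set X) (alpha eta theta : R).

Lemma lebesgue_number U :
  compact [set: X] -> U `<=` open -> \bigcup_(V in U) V = [set: X] ->
  exists2 delta : R, 0 < delta & forall x, exists2 V, U V &
    forall y, mdist x y < delta -> V y.
Proof.
move=> cptX Uopen Ucover.
pose P (d : R) (x : X) := exists2 V, U V & forall y, mdist x y < d -> V y.
(* Compactness, in its near-covering form, makes a local statement uniform: if the ball of radius
   [r] about [x] lies in [V], then [V] serves every [x'] within [r / 2] of [x] and every
   [d <= r / 2]. *)
have [] : \forall d \near 0^'+, [set: X] `<=` P d.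
  apply: (iffLR (compact_near_coveringP _) cptX) => x _.
  have [V UV Vx] : (\bigcup_(V in U) V) x by rewrite Ucover.
  have /metricType_numDomainType.nbhs_mdistP[/= r r0 rV] : nbhs x V.
    by apply: open_nbhs_nbhs; split=> //; exact: Uopen.
  exists (ball x (r / 2), [set d | d <= r / 2]).
    split=> /=; first by apply: nbhsx_ballx; rewrite divr_gt0.
    by apply: nbhs_right_le; rewrite divr_gt0.
  move=> [x' d]/= []; rewrite ballEmdist /= => xx' dr.
  exists V => // y x'y; apply: rV => /=.
  have := metric_triangle x x' y; lra.
move=> e /= e0 He; exists (e / 2); first by rewrite divr_gt0.
move=> x; apply: (He (e / 2)) => //=; last by rewrite divr_gt0.
by rewrite sub0r normrN ger0_norm; lra.
Qed.

Lemma compact_unif_continuous eta :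
  compact [set: X] -> continuous phi -> 0 < eta ->
  exists2 delta : R, 0 < delta & forall x y, mdist x y < delta -> `|phi x - phi y| <= eta.
Proof.
move=> cptX phicont eta0.
(* Uniform continuity is read off a Lebesgue number of the cover by all open sets on which [phi]
   varies by at most [eta]. *)
pose U := [set V : set X | open V /\ forall x y, V x -> V y -> `|phi x - phi y| <= eta].
have [| |delta d0 dP] := @lebesgue_number U cptX.
- by move=> V [].
- apply/seteqP; split=> // x _.
  exists (phi @^-1` ball (phi x) (eta / 2)).
    split=> [|y z]; first by apply: open_comp => [? _|]; [exact: phicont | exact: ball_open].
    rewrite /= /ball/= => h1 h2.
    rewrite (_ : phi y - phi z = (phi x - phi z) - (phi x - phi y)); last by lra.
    by apply: le_trans (ler_normB _ _) _; lra.
  by rewrite /=; apply: ballxx; rewrite divr_gt0.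
exists delta => // x y xy; have [V [_ VU] xV] := dP x.
by apply: VU; apply: xV => //; rewrite mdistxx.
Qed.

Lemma open_forall_ltn (A : nat -> set X) n : (forall j, (j < n)%N -> open (A j)) ->
  open [set x | forall j, (j < n)%N -> A j x].
Proof.
elim: n => [|n IHn] Aopen.
  by rewrite (_ : [set _ | _] = setT); [exact: openT | apply/seteqP; split].
rewrite (_ : [set _ | _] = [set x | forall j, (j < n)%N -> A j x] `&` A n).
  by apply: openI; [apply: IHn => j jn; apply: Aopen; exact: ltnW | exact: Aopen].
apply/seteqP; split=> x /=; first by move=> h; split=> [j jn|]; apply: h => //; exact: ltnW.
by move=> [h An] j; rewrite ltnS leq_eqVlt => /predU1P[->//|]; exact: h.
Qed.

Lemma open_mdist_ball (x : X) (e : R) : open [set y | mdist x y < e].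
Proof.
rewrite openE => y /= xy; apply/metricType_numDomainType.nbhs_mdistP.
exists (e - mdist x y) => /=.
  by rewrite subr_gt0.
by move=> z /= yz; have := metric_triangle x y z; lra.
Qed.

(** The list is free of duplicates so that summing over it agrees with summing over its underlying
    set, hence stays below the sum over [G]. *)
Lemma compact_finite_subcover (T : choiceType) (Z : set X) (G : set T)
    (F : T -> set X) :
  compact Z -> (forall t, G t -> open (F t)) -> Z `<=` \bigcup_(t in G) F t ->
  exists D : seq T, [/\ uniq D, forall t, t \in D -> G t &
    Z `<=` \bigcup_(t in [set` D]) F t].
Proof.
rewrite compact_cover => cptZ Fopen /(cptZ _ _ _ Fopen)[E EG ZE].
exists (finmap.enum_fset E); split=> [|t /EG|//]; [exact: finmap.fset_uniq|exact: set_mem].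
Qed.

(** * Orbits, Birkhoff sums and weights *)

Lemma continuous_orbit_map n : (forall i, (0 < i)%N -> continuous (f i)) ->
  continuous (orbit_map f n).
Proof.
move=> fcont; elim: n => [|n IHn] /= x; first exact: cvg_id.
by apply: continuous_comp; [exact: IHn | exact: fcont].
Qed.

Lemma open_bowen_ball n x eps : (forall i, (0 < i)%N -> continuous (f i)) ->
  open (bowen_ball f n x eps).
Proof.
move=> fcont; apply: (@open_forall_ltn
  (fun j => orbit_map f j @^-1` [set y | mdist (orbit_map f j x) y < eps])) => j _.
apply: open_comp => [? _|]; last exact: open_mdist_ball.
exact: continuous_orbit_map.
Qed.

Lemma open_string_set U s : (forall i, (0 < i)%N -> continuous (f i)) ->
  U `<=` open -> is_string U s -> open (string_set f s).
Proof.
move=> fcont Uopen sU; apply: (@open_forall_ltn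
  (fun j => orbit_map f j @^-1` nth set0 s j)) => j js.
apply: open_comp => [? _|]; last by apply: Uopen; exact: sU.
exact: continuous_orbit_map.
Qed.

Lemma birkhoff_sum_close n eta x y :
  (forall j, (j < n)%N -> `|phi (orbit_map f j x) - phi (orbit_map f j y)| <= eta) ->
  birkhoff_sum f phi n y <= birkhoff_sum f phi n x + eta * n%:R.
Proof.
move=> close; rewrite /birkhoff_sum -lerBlDl -sumrB.
rewrite mulr_natr -[X in eta *+ X]card_ord -sumr_const; apply: ler_sum => j _.
have := close j (ltn_ord j); rewrite distrC => h; apply: le_trans h; exact: ler_norm.
Qed.

Lemma weight_ge0 alpha n (A : set X) : (0 <= weight f phi alpha n A)%E.
Proof. exact: expeR_ge0. Qed.

(** The supremum over [A'] is at least the value at the single point [x], so it suffices to compare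
    all of [A] with [x]. The two lengths may differ, as they do when a string loses a letter. *)
Lemma weight_le c alpha alpha' n n' (A A' : set X) x : A' x ->
  (forall y, A y -> - alpha * n%:R + birkhoff_sum f phi n y <=
                    c + (- alpha' * n'%:R + birkhoff_sum f phi n' x)) ->
  (weight f phi alpha n A <= (expR c)%:E * weight f phi alpha' n' A')%E.
Proof.
move=> A'x AA'.
pose t := - alpha' * n'%:R + birkhoff_sum f phi n' x.
apply: (@le_trans _ _ ((expR c)%:E * (expR t)%:E)%E); last first.
  apply: lee_pmul => //; rewrite ?lee_fin ?expR_ge0//.
  rewrite -[(expR t)%:E]/(expeR t%:E) lee_expeR EFinD leeD2l//.
  by apply: ereal_sup_ubound; exists x.
rewrite -EFinM -expRD -[(expR _)%:E]/(expeR (c + t)%:E) lee_expeR.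
rewrite -leeBrDl// -EFinB; apply: ge_ereal_sup => _ [y Ay <-].
by rewrite lee_fin lerBrDl; exact: AA'.
Qed.

Lemma sum_undup_le (T : eqType) (a : T -> \bar R) (s : seq T) :
  (forall t, 0 <= a t)%E -> (\sum_(t <- undup s) a t <= \sum_(t <- s) a t)%E.
Proof.
move=> a0; elim: s => [|t s IHs] /=; first by rewrite !big_nil.
case: ifP => _; rewrite !big_cons; last by rewrite leeD2l.
by apply: le_trans IHs _; rewrite leeDr.
Qed.

Lemma esum_set_seq_le (T : choiceType) (a : T -> \bar R) (s : seq T) :
  (forall t, 0 <= a t)%E -> (\esum_(t in [set` s]) a t <= \sum_(t <- s) a t)%E.
Proof.
move=> a0; apply: le_trans (sum_undup_le s a0).
rewrite (_ : [set` s] = [set` undup s]); last first.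
  by apply/seteqP; split=> t /=; rewrite mem_undup.
by rewrite esum_fset// -fsbig_seq// undup_uniq.
Qed.

Lemma ereal_inf_le_scale (K : R) (A B : set \bar R) : 0 < K ->
  (forall b, B b -> exists2 a, A a & (a <= K%:E * b)%E) ->
  (ereal_inf A <= K%:E * ereal_inf B)%E.
Proof.
move=> K0 BA; rewrite -ereal_inf_pZl//.
apply: le_ereal_inf_tmp => _ [b Bb <-]; have [a Aa ab] := BA b Bb.
by apply: ge_ereal_inf; exists a.
Qed.

(** Along [n] steps the Birkhoff sums differ by at most [eta * n], exactly what the shift of [alpha]
    by [eta] removes. *)
Lemma weight_modulus alpha eta n (A A' : set X) x : A' x ->
  (forall y, A y -> forall j, (j < n)%N ->
     `|phi (orbit_map f j x) - phi (orbit_map f j y)| <= eta) ->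
  (weight f phi (alpha + eta) n A <= weight f phi alpha n A')%E.
Proof.
move=> A'x close; rewrite -[leRHS]mul1e -expR0; apply: weight_le A'x _ => y Ay.
by have := birkhoff_sum_close (close y Ay); lra.
Qed.

Lemma top_sum_ge0 Z alpha U N theta : (0 <= top_sum f Z alpha phi U N theta)%E.
Proof.
apply: le_ereal_inf_tmp => _ [G _ <-]; apply: esum_ge0 => s _; exact: weight_ge0.
Qed.

Lemma meas_sum_ge0 (mu : probability (borelType X) R) alpha eps N theta :
  (0 <= meas_sum f mu alpha phi eps N theta)%E.
Proof.
apply: le_ereal_inf_tmp => _ [G _ <-]; apply: sume_ge0 => s _; exact: weight_ge0.
Qed.

(** * Comparison of strings and Bowen balls at a fixed scale *)

Lemma mdist_lt_mesh U V (d : R) x y : (mesh U < d%:E)%E -> U V -> V x -> V y ->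
  mdist x y < d.
Proof.
move=> Ud UV Vx Vy; rewrite -lte_fin; apply: le_lt_trans Ud.
apply: (@le_trans _ _ (diameter V)); last by apply: ereal_sup_ubound; exists V.
by apply: ereal_sup_ubound; exists (x, y).
Qed.

(** With [limn_einf] or [limn_esup] for [lim_op], this and the next definition unfold to the lower
    and upper pressures. *)
Definition cover_pressure (lim_op : (nat -> \bar R) -> \bar R) Z theta U : \bar R :=
  critical_value (fun alpha => lim_op (fun N => top_sum f Z alpha phi U N theta)).

Definition meas_pressure_at (lim_op : (nat -> \bar R) -> \bar R)
    (mu : probability (borelType X) R) theta eps : \bar R :=
  critical_value (fun alpha => lim_op (fun N => meas_sum f mu alpha phi eps N theta)).

Context (fcont : forall i, (0 < i)%N -> continuous (f i)).
Context (lim_op : (nat -> \bar R) -> \bar R) (dom_lim : dominates_vanishing lim_op).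
Implicit Types (mu : probability (borelType X) R).

Definition modulus eta (d : R) : Prop :=
  forall x y, mdist x y < d -> `|phi x - phi y| <= eta.

Lemma measurable_bowen_union (S : seq (X * nat)) eps :
  measurable (\bigcup_(p in [set` S]) bowen_ball f p.2 p.1 eps : set (borelType X)).
Proof.
apply: open_measurable_borel; apply: bigcup_open => p _; exact: open_bowen_ball.
Qed.

(** Enlarging the radius keeps a [mu]-cover. It also raises the supremum over each ball, but every
    point of the larger ball is compared with the common center. *)
Lemma meas_pressure_at_quasi_decreasing mu theta eta eps eps' :
  modulus eta eps -> 0 < eps' -> eps' <= eps ->
  (meas_pressure_at lim_op mu theta eps
     <= meas_pressure_at lim_op mu theta eps' + eta%:E)%E.
Proof.
move=> mod_eps eps'0 eps'eps; apply: critical_value_leD => alpha.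
apply: (dom_lim ltr01) => [N|N|N]; [exact: meas_sum_ge0|exact: meas_sum_ge0|].
apply: ereal_inf_le_scale => // _ [S [Swin Sfull] <-].
exists (\sum_(p <- S) weight f phi (alpha + eta) p.2 (bowen_ball f p.2 p.1 eps))%E.
  exists S => //; split=> //.
  apply: probability_eq1_subset Sfull; [exact: measurable_bowen_union..|].
  move=> x [p Sp px]; exists p => // j jp.
  by apply: lt_le_trans eps'eps; exact: px.
rewrite mul1e; apply: lee_sum => p _; apply: (@weight_modulus _ _ _ _ _ p.1).
  by move=> j _; rewrite mdistxx.
by move=> y yp j jp; apply: mod_eps; exact: yp.
Qed.

Lemma cover_pressure_le_meas_pressure_at mu Z theta eta eps d U :
  (forall A, open A -> mu A = 1%E -> Z `<=` closure A) ->
  0 < eps -> finite_open_cover U ->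
  (forall x, exists2 V, U V & forall y, mdist x y < eps *+ 2 -> V y) ->
  (mesh U < d%:E)%E -> modulus eta d ->
  (cover_pressure lim_op Z theta U <= meas_pressure_at lim_op mu theta eps + eta%:E)%E.
Proof.
move=> mu_full eps0 [_ Uopen _] Ueps Ud mod_d; apply: critical_value_leD => alpha.
apply: (dom_lim ltr01) => [N|N|N]; [exact: top_sum_ge0|exact: meas_sum_ge0|].
apply: ereal_inf_le_scale => // _ [S [Swin Sfull] <-].
have Vex x : exists V, U V /\ forall y, mdist x y < eps *+ 2 -> V y.
  by have [V] := Ueps x; exists V.
have [V VP] := boolp.choice Vex.
(* A ball becomes a string of its own length: the [j]-th letter is a cover element containing the
   [eps *+ 2]-ball about the [j]-th orbit point of the center. *)
pose strg (p : X * nat) := mkseq (fun j => V (orbit_map f j p.1)) p.2.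
have strgE p j : (j < p.2)%N -> nth set0 (strg p) j = V (orbit_map f j p.1).
  by move=> jp; rewrite nth_mkseq.
exists (\esum_(s in [set` map strg S])
    weight f phi (alpha + eta) (size s) (string_set f s)).
  exists [set` map strg S] => //; split.
  - exact: finite_set_countable.
  - move=> _ /mapP[p pS ->]; split.
      move=> j; rewrite size_mkseq => jp; rewrite strgE//.
      by have [] := VP (orbit_map f j p.1).
    have [Np pN] := Swin p pS; rewrite size_mkseq; split=> // theta0.
    by apply: le_lt_trans (pN theta0) _; rewrite ltrDl.
  - move=> x Zx.
    (* Only the closure of the union of balls is known to contain [x]. A Bowen neighborhood of [x]
       as long as the longest ball meets some ball at [y], and the triangle inequality through [y]
       keeps [x] within [eps *+ 2] of that center's orbit. *)
    pose n := \max_(p <- S) p.2.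
    have nx : nbhs x (bowen_ball f n x eps).
      apply: open_nbhs_nbhs; split; first exact: open_bowen_ball.
      by move=> j _; rewrite mdistxx.
    have [y [[p Sp py] xy]] := mu_full _ (bigcup_open (fun p _ =>
      open_bowen_ball p.2 p.1 eps fcont)) Sfull x Zx _ nx.
    exists (strg p); first exact: map_f.
    move=> j; rewrite size_mkseq => jp; rewrite strgE//.
    have [_] := VP (orbit_map f j p.1); apply.
    have jn : (j < n)%N by apply: leq_trans jp _; exact: leq_bigmax_seq.
    have := metric_triangle (orbit_map f j p.1) (orbit_map f j y) (orbit_map f j x).
    move=> h; apply: le_lt_trans h _; rewrite mulr2n ltrD//; first exact: py.
    by rewrite metric_sym; exact: xy.
rewrite mul1e.
(* Different balls may give the same string, which the [\esum] counts only once. *)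
apply: (@le_trans _ _ (\sum_(s <- map strg S)
    weight f phi (alpha + eta) (size s) (string_set f s))%E).
  by apply: esum_set_seq_le => s; exact: weight_ge0.
rewrite big_map; apply: lee_sum => p _; rewrite size_mkseq.
apply: (@weight_modulus _ _ _ _ _ p.1).
  by move=> j _; rewrite mdistxx.
move=> y yp j jp; apply: mod_d.
have [UV Vp] := VP (orbit_map f j p.1).
apply: mdist_lt_mesh Ud UV _ _; first by apply: Vp; rewrite mdistxx mulrn_wgt0.
by rewrite -strgE//; apply: yp; rewrite size_mkseq.
Qed.


(* A string of the topological window may have one letter too many for the
   measure-theoretic window; dropping its last letter costs the factor
   [exp (|alpha| + C)], which is invisible to the critical value. *)
Lemma meas_pressure_at_le_cover_pressure mu Z theta eta eps (C : R) U :
  compact Z -> mu Z = 1%E -> 0 <= theta <= 1 ->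
  (forall x, `|phi x| <= C) -> modulus eta eps ->
  finite_open_cover U -> (mesh U < eps%:E)%E ->
  (meas_pressure_at lim_op mu theta eps <= cover_pressure lim_op Z theta U + eta%:E)%E.
Proof.
move=> cptZ muZ /andP[theta0 theta1] phiC mod_eps [_ Uopen _] Ueps.
have C0 : 0 <= C := le_trans (normr_ge0 _) (phiC point).
apply: critical_value_leD => alpha.
pose K := expR (`|alpha| + C).
apply: (dom_lim (expR_gt0 (`|alpha| + C))) => [N|N|N];
  [exact: meas_sum_ge0|exact: top_sum_ge0|].
apply: ereal_inf_le_scale => [|_ [G [_ GU ZG] <-]]; first exact: expR_gt0.
have [D [Duniq DG ZD]] := compact_finite_subcover cptZ
  (fun s Gs => open_string_set fcont Uopen (GU s Gs).1) ZG.
(* The center is any point of [string_set f s]. For an empty [string_set f s] the pair [(point, 0)]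
   is a dummy, filtered out by [nonempty] below. *)
have ball_ex s : exists p : X * nat, G s -> string_set f s !=set0 ->
    [/\ string_set f s p.1, ball_window theta N p.2
      & p.2 = size s \/ p.2.+1 = size s].
  have [[x sx]|] := pselect (string_set f s !=set0); last first.
    by move=> ns; exists (point, 0%N).
  have [fits|misfit] := pselect (ball_window theta N (size s)).
    by exists (x, size s) => _ _; split=> //; left.
  exists (x, (size s).-1) => Gs _; have [_ [Ns sN]] := GU s Gs.
  (* For [theta = 0] the two windows coincide, so a misfit forces [theta > 0] and a length above
     [N / theta]. As [theta <= 1], that length exceeds [N], so removing one letter leaves at least
     [N]. *)
  have theta_gt0 : 0 < theta.
    rewrite lt_neqAle theta0 andbT; apply/eqP => theta_eq0; apply: misfit.
    by split=> //; rewrite -theta_eq0 ltxx.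
  have Nsize : N%:R / theta < (size s)%:R.
    by rewrite ltNge; apply/negP => h; apply: misfit; split.
  have NNt : (N%:R : R) <= N%:R / theta by rewrite ler_pdivlMr// ler_piMr.
  have Nlt : (N < size s)%N by rewrite -(ltr_nat R); exact: le_lt_trans Nsize.
  have spos : (0 < size s)%N := leq_trans (ltn0Sn N) Nlt.
  split=> //=; last by right; rewrite prednK.
  split=> [|_]; first by rewrite -ltnS prednK.
  by have := sN theta_gt0; rewrite -{1}(prednK spos) -natr1 ltrD2r => /ltW.
have [h hP] := boolp.choice ball_ex.
pose nonempty s := `[< string_set f s !=set0 >].
pose S := [seq h s | s <- D & nonempty s].
exists (\sum_(p <- S) weight f phi (alpha + eta) p.2 (bowen_ball f p.2 p.1 eps))%E.
  exists S => //; split.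
    move=> _ /mapP[s + ->]; rewrite mem_filter => /andP[/asboolP s0 sD].
    by have Gs := DG s sD; have [] := hP s Gs s0.
  apply: probability_eq1_subset muZ; [|exact: measurable_bowen_union|].
    exact: compact_measurable_borel.
  (* The point [x] and the chosen center follow the same string, whose letters have diameter below
     [eps]; hence the Bowen balls cover all of [Z]. *)
  move=> x /ZD[s sD sx]; have Gs := DG s sD.
  have s0 : string_set f s !=set0 by exists x.
  exists (h s).
    by apply/mapP; exists s => //; rewrite mem_filter; apply/andP; split=> //; exact/asboolP.
  have [sh _ hsize] := hP s Gs s0.
  move=> j jh; have js : (j < size s)%N.
    by case: hsize jh => [->//|<- jh]; exact: ltnW.
  have [sU _] := GU s Gs.
  by apply: mdist_lt_mesh Ueps (sU j js) _ _; [exact: sh|exact: sx].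
apply: (@le_trans _ _ (K%:E *
    \sum_(s <- D) weight f phi alpha (size s) (string_set f s)))%E; last first.
  apply: lee_wpmul2l; first by rewrite lee_fin expR_ge0.
  apply: esum_ge; exists [set` D].
    by split=> //; exact: finite_seq.
  by rewrite fsbig_seq.
rewrite big_map big_filter big_mkcond ge0_sume_distrr; last first.
  by move=> s _; exact: weight_ge0.
rewrite big_seq [leRHS]big_seq; apply: lee_sum => s sD.
case: ifPn => [/asboolP s0|_]; last first.
  by apply: mule_ge0; [rewrite lee_fin expR_ge0|exact: weight_ge0].
have Gs := DG s sD.
have [sh _ hsize] := hP s Gs s0.
apply: weight_le sh _ => y hy.
have Sy : birkhoff_sum f phi (h s).2 y <=
    birkhoff_sum f phi (h s).2 (h s).1 + eta * (h s).2%:R.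
  by apply: birkhoff_sum_close => j jh; apply: mod_eps; exact: hy.
have a1 := ler_norm alpha; have a0 := normr_ge0 alpha.
(* If a letter was dropped, the last orbit step adds [phi - alpha] to the exponent of the string,
   which is at least [- (C + |alpha|)]. *)
case: hsize => [<-|<-]; first by lra.
rewrite {2}/birkhoff_sum big_ord_recr /= -/(birkhoff_sum f phi _ _) -natr1.
have := phiC (orbit_map f (h s).2 (h s).1); rewrite ler_norml => /andP[].
by lra.
Qed.

Lemma cover_pressure_set0 theta U : lim_op (fun=> 0%E) = 0%E ->
  cover_pressure lim_op set0 theta U = -oo%E.
Proof.
move=> lim0; rewrite /cover_pressure /critical_value.
rewrite (_ : [set alpha | _] = setT); first exact: ereal_inf_real.
apply/seteqP; split=> // alpha _ /=; rewrite -[RHS]lim0; congr lim_op.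
apply/funext => N; apply/eqP; rewrite eq_le top_sum_ge0 andbT.
apply: ereal_inf_lbound; exists set0; last exact: esum_set0.
by split.
Qed.

(** * Limits as the scale tends to 0, and the variational principle *)

Lemma compact_bounded_by : compact [set: X] -> continuous phi ->
  exists C, forall x, `|phi x| <= C.
Proof.
move=> cptX phicont.
have : compact (phi @` [set: X]).
  by apply: continuous_compact => //; exact: continuous_subspaceT.
move=> /compact_bounded[M [_ /(_ (M + 1))]]; rewrite ltrDl => /(_ ltr01) H.
by exists (M + 1) => x; apply: H; exists x.
Qed.

Lemma tends_to_meas_pressure_at mu theta : compact [set: X] -> continuous phi ->
  exists l, tends_to 0^'+ (meas_pressure_at lim_op mu theta) l.
Proof.
move=> cptX phicont; apply: tends_to_liminf => eta eta0.
have [d d0 dP] := compact_unif_continuous cptX phicont eta0.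
exists d => // e e' e'0 e'e ed; apply: meas_pressure_at_quasi_decreasing => // x y xy.
by apply: dP; exact: lt_le_trans ed.
Qed.

(** Properness means that finite open covers of arbitrarily small mesh exist: finitely many balls of
    radius [d / 3] cover the space, and their diameters are at most [2 d / 3]. *)
Lemma mesh_to0_filter : compact [set: X] -> ProperFilter (@mesh_to0 R X).
Proof.
move=> cptX; apply: filter_from_proper.
  apply: filter_from_filter; first by exists 1 => /=.
  move=> d d' d0 d'0; exists (Order.min d d').
    by rewrite /= lt_min d0 d'0.
  move=> U [Ufin Um]; split; (split=> //; apply: lt_le_trans Um _).
    by rewrite lee_fin ge_min lexx.
  by rewrite lee_fin ge_min lexx orbT.
move=> d /= d0.
have [|D [_ _ XD]] := compact_finite_subcover cptX (G := setT)
    (F := fun x : X => [set y | mdist x y < d / 3]) (fun x _ => @open_mdist_ball x _).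
  by move=> x _; exists x => //=; rewrite mdistxx divr_gt0.
exists [set [set y | mdist x y < d / 3] | x in [set` D]]; split.
  split.
  - exact/finite_image/finite_seq.
  - by move=> _ [x _ <-]; exact: open_mdist_ball.
  - apply/seteqP; split=> // y _; have [x xD xy] := XD y I.
    by exists [set y | mdist x y < d / 3] => //; exists x.
apply: (@le_lt_trans _ _ (d / 3 *+ 2)%:E); last by rewrite lte_fin; lra.
apply: ge_ereal_sup => _ [_ [x _ <-] <-].
apply: ge_ereal_sup => _ [[y z] [/= xy xz] <-].
rewrite lee_fin; have := metric_triangle y x z; rewrite (metric_sym y x); lra.
Qed.

(** For a measure that sees all of [Z], both comparisons are available, so the cover pressures
    inherit the limit [l] of the measure pressures. *)
Lemma tends_to_cover_pressure mu Z theta l :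
  compact [set: X] -> compact Z -> continuous phi -> 0 <= theta <= 1 ->
  mu Z = 1%E -> (forall A, open A -> mu A = 1%E -> Z `<=` closure A) ->
  tends_to 0^'+ (meas_pressure_at lim_op mu theta) l ->
  tends_to (@mesh_to0 R X) (cover_pressure lim_op Z theta) l.
Proof.
move=> cptX cptZ phicont theta01 muZ mu_full [up low].
have [C phiC] := compact_bounded_by cptX phicont.
split=> [eta eta0|eta a eta0 al].
- have eta20 : 0 < eta / 2 by rewrite divr_gt0.
  have [d d0 dP] := compact_unif_continuous cptX phicont eta20.
  exists d => // U [Ucov Ud] /=.
  have [_ Uopen UX] := Ucov.
  have [r r0 rP] := lebesgue_number cptX Uopen UX.
  (* For the upper half the cover comes first; the radius is then taken below half its Lebesgue
     number. *)
  near (0 : R)^'+ => eps.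
  have eps0 : 0 < eps by near: eps; exact: nbhs_right_gt.
  rewrite (_ : eta = eta / 2 + eta / 2); last by lra.
  rewrite EFinD addeA.
  apply: (@le_trans _ _ (meas_pressure_at lim_op mu theta eps + (eta / 2)%:E)%E).
    apply: (cover_pressure_le_meas_pressure_at _ mu_full eps0 Ucov _ Ud dP) => x.
    have [V UV xV] := rP x; exists V => // y xy; apply: xV.
    apply: lt_trans xy _; rewrite mulr2n.
    have : eps < r / 2 by near: eps; apply: nbhs_right_lt; rewrite divr_gt0.
    by lra.
  by apply: leeD2r; near: eps; exact: up.
- have eta20 : 0 < eta / 2 by rewrite divr_gt0.
  have [d d0 dP] := compact_unif_continuous cptX phicont eta20.
  (* For the lower half the radius comes first and bounds the mesh of the covers allowed. *)
  near (0 : R)^'+ => eps.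
  have eps0 : 0 < eps by near: eps; exact: nbhs_right_gt.
  have epsd : eps < d by near: eps; exact: nbhs_right_lt.
  exists eps => // U [Ucov Ueps] /=.
  rewrite (_ : eta = eta / 2 + eta / 2); last by lra.
  rewrite EFinD addeA.
  apply: (@le_trans _ _ (meas_pressure_at lim_op mu theta eps + (eta / 2)%:E)%E).
    by near: eps; exact: low.
  apply: leeD2r; apply: (meas_pressure_at_le_cover_pressure cptZ muZ theta01 phiC) => //.
  by move=> x y xy; apply: dP; exact: lt_trans epsd.
Unshelve. all: by end_near. Qed.

Lemma meas_limit_le_cover_limit mu Z theta l l' :
  compact [set: X] -> compact Z -> continuous phi -> 0 <= theta <= 1 ->
  mu Z = 1%E ->
  tends_to 0^'+ (meas_pressure_at lim_op mu theta) l' ->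
  tends_to (@mesh_to0 R X) (cover_pressure lim_op Z theta) l ->
  (l' <= l)%E.
Proof.
move=> cptX cptZ phicont theta01 muZ [_ low] [up _].
have [C phiC] := compact_bounded_by cptX phicont.
have meshF := mesh_to0_filter cptX.
(* Testing against reals below [l'] treats finite and infinite [l'] alike. *)
suff H (a : R) : (a%:E < l')%E -> (a%:E <= l)%E.
  case: l' H {low} => [r| |] H; [| |by rewrite leNye]; last first.
    by rewrite leye_eq; apply/eqP/eqyP => A _; apply: H; rewrite ltry.
  apply/lee_subgt0Pr => e e0; rewrite -EFinB; apply: H.
  by rewrite lte_fin ltrBlDr ltrDl.
move=> al'; apply/lee_addgt0Pr => eta eta0.
have eta30 : 0 < eta / 3 by rewrite divr_gt0.
have [d d0 dP] := compact_unif_continuous cptX phicont eta30.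
near (0 : R)^'+ => eps.
have eps0 : 0 < eps by near: eps; exact: nbhs_right_gt.
have epsd : eps < d by near: eps; exact: nbhs_right_lt.
have [U [[Ucov Ueps] Ul]] := filter_ex (filterI
  (ex_intro2 _ _ eps eps0 (fun U Ueps => Ueps)) (up _ eta30)).
(* One third each for passing from [a] to the radius [eps], from [eps] to the cover [U], and from
   [U] to [l]. *)
rewrite (_ : eta = eta / 3 + eta / 3 + eta / 3); last by lra.
rewrite 2!EFinD !addeA.
apply: (@le_trans _ _ (meas_pressure_at lim_op mu theta eps + (eta / 3)%:E)%E).
  by near: eps; exact: low.
apply: leeD2r; apply: (@le_trans _ _ (cover_pressure lim_op Z theta U + (eta / 3)%:E)%E).
  apply: (meas_pressure_at_le_cover_pressure cptZ muZ theta01 phiC) => //.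
  by move=> x y xy; apply: dP; exact: lt_trans epsd.
exact: leeD2r.
Unshelve. all: by end_near. Qed.

Lemma pressure_variational_principle Z theta : lim_op (fun=> 0%E) = 0%E ->
  compact [set: X] -> compact Z -> continuous phi -> 0 <= theta <= 1 ->
  lim (cover_pressure lim_op Z theta U @[U --> @mesh_to0 R X])
    = ereal_sup [set lim (meas_pressure_at lim_op mu theta eps @[eps --> 0^'+])
                | mu in [set mu : probability (borelType X) R | mu Z = 1%E]].
Proof.
move=> lim0 cptX cptZ phicont theta01.
have meshF := mesh_to0_filter cptX.
(* If [Z] is empty, no probability qualifies and both sides are [-oo]. Otherwise the supremum is
   attained at the measure [mu0] with dense atoms. *)
have [Z0|/set0P Z0] := eqVneq Z set0.
  rewrite Z0 (_ : [set mu | _] = set0) ?image_set0 ?ereal_sup0; last first.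
    apply/seteqP; split=> // mu /=; rewrite measure0 => /esym/eqP.
    by rewrite onee_eq0.
  apply: cvg_lim => //; rewrite (_ : cover_pressure _ _ _ = fun=> -oo%E).
    exact: cvg_cst.
  by apply/funext => U; exact: cover_pressure_set0.
have [mu0 mu0Z mu0_full] := full_support_probability cptX Z0.
have [l mu0l] := tends_to_meas_pressure_at mu0 theta cptX phicont.
have Zl := tends_to_cover_pressure cptX cptZ phicont theta01 mu0Z mu0_full mu0l.
rewrite (cvg_lim _ (tends_to_cvg _ Zl))//; apply/eqP; rewrite eq_le; apply/andP; split.
  apply: ereal_sup_ubound; exists mu0 => //.
  by apply: cvg_lim => //; exact: tends_to_cvg.
apply: ge_ereal_sup => _ [mu muZ <-].
have [l' mul'] := tends_to_meas_pressure_at mu theta cptX phicont.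
rewrite (cvg_lim _ (tends_to_cvg _ mul'))//.
exact: meas_limit_le_cover_limit muZ mul' Zl.
Qed.

End Dynamics.

Theorem theorem5p4 (R : realType) (X : pointedMetricType R)
    (cptX : compact [set: X])
    (f : nat -> X -> X) (fcont : forall i, (0 < i)%N -> continuous (f i))
    (Z : set X) (cptZ : compact Z)
    (phi : X -> R) (phicont : continuous phi)
    (theta : R) (theta01 : 0 <= theta <= 1) :
  lower_pressure f Z phi theta
    = ereal_sup [set lower_meas_pressure f mu phi theta
                | mu in [set mu : probability (borelType X) R | mu Z = 1%E]]
  /\
  upper_pressure f Z phi theta
    = ereal_sup [set upper_meas_pressure f mu phi theta
                | mu in [set mu : probability (borelType X) R | mu Z = 1%E]].
Proof.
(* These two values are the normalization of [lim_op] that the case of empty [Z] requires. *)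
have [lim_inf0 lim_sup0] := cvg_limn_einf_sup (@cvg_cst _ (0%E : \bar R) _ \oo _).
split.
- exact: (pressure_variational_principle fcont dominates_vanishing_limn_einf).
- exact: (pressure_variational_principle fcont dominates_vanishing_limn_esup).
Qed.
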